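(* For every positive integer $k$, let $J_k$ be the graph constructed as follows. Take a star $K_{1,3^k}$ with center $c$, and label its $3^k$ leaves bijectively by the ternary strings of length $k$ (digits $0,1,2$). Add $2k$ new vertices $s_1,\dots,s_k,r_1,\dots,r_k$, where for each $i$: $s_i$ is adjacent to every leaf whose label has $i$-th digit $0$; $r_i$ is adjacent to every leaf whose label has $i$-th digit $0$ or $1$; and $r_i$ is adjacent to $s_i$ (there are no other edges). Finally delete the leaf labeled by the all-$1$ string and the $k$ leaves whose labels contain exactly one $0$ and $k-1$ ones. Then $\dim(J_k)=k$ and $\textnormal{ftdim}(J_k)\ge 3^{k-1}-k$.
   Context: Graphs are finite, simple, undirected; $\textnormal{dist}(u,v)=\infty$ between different components. A set $S=\{v_1,\dots,v_k\}$ of vertices is a resolving set of $G$ if the vectors $(\textnormal{dist}(u,v_1),\dots,\textnormal{dist}(u,v_k))$ are pairwise distinct over $u\in V(G)$; $\dim(G)$ is the minimum size of a resolving set. $\textnormal{ftdim}(G)$ is the minimum size of a nonempty $S\subseteq V(G)$ such that $S-\{s\}$ is a resolving set for every $s\in S$.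
   Formalization: The equality dim(J_k) = k is proved only for k ≥ 2: for k = 1 the leaves 0 and 1 are deleted, J_1 is two disjoint edges, and dim(J_1) = 2. The bound on ftdim(J_k) is proved for every k ≥ 1. *)

(* Defs.v *)
From HB Require Import structures.
From mathcomp Require Import all_boot.

Set Implicit Arguments.
Unset Strict Implicit.
Unset Printing Implicit Defensive.

Record sgraph := SGraph {
  svertex :> finType;
  sedge : rel svertex;
  sedge_sym : symmetric sedge;
  sedge_irrefl : irreflexive sedge }.

Definition walk (G : sgraph) (n : nat) (u v : G) : bool :=
  [exists p : n.-tuple G, path (@sedge G) u p && (last u p == v)].

Lemma connect_walk (G : sgraph) (u v : G) :
  connect (@sedge G) u v -> exists n, walk n u v.
Proof.
move=> /connectP[p pp ->]; exists (size p); apply/existsP.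
by exists (in_tuple p); rewrite pp eqxx.
Qed.

(* None is the infinite distance between different components. *)
Definition dist (G : sgraph) (u v : G) : option nat :=
  if @idP (connect (@sedge G) u v) is ReflectT h
  then Some (ex_minn (connect_walk h)) else None.

Lemma dist_SomeP (G : sgraph) (u v : G) n :
  dist u v = Some n <-> walk n u v /\ forall m, walk m u v -> n <= m.
Proof.
rewrite /dist; case: {-}_ / idP => [h|nh].
  case: ex_minnP => d wd dmin; split=> [[<-] //|[wn nmin]].
  by congr Some; apply/eqP; rewrite eqn_leq dmin // nmin.
split=> // -[/existsP[p /andP[pp /eqP lp]] _].
by case: nh; apply/connectP; exists p.
Qed.

Lemma dist_eq0 (G : sgraph) (u v : G) : (dist u v == Some 0) = (u == v).
Proof.
apply/eqP/eqP => [/dist_SomeP[/existsP[p] + _]|<-].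
  by rewrite (tuple0 p) => /eqP.
apply/dist_SomeP; split=> //.
by apply/existsP; exists [tuple]; rewrite /= eqxx.
Qed.

Definition dist_vector (G : sgraph) (S : {set G}) (u : G) : seq (option nat) :=
  [seq dist u s | s <- enum S].

Definition resolving (G : sgraph) (S : {set G}) : bool :=
  injectiveb (dist_vector S).

Definition ft_resolving (G : sgraph) (S : {set G}) : bool :=
  (S != set0) && [forall s in S, resolving (S :\ s)].

Lemma resolvingP (G : sgraph) (S : {set G}) :
  reflect (forall u v, {in S, forall s, dist u s = dist v s} -> u = v)
          (resolving S).
Proof.
apply: (iffP (injectiveP _)) => inj u v.
  move=> duv; apply: inj; apply/eq_in_map => s.
  by rewrite mem_enum => /duv.
by move=> /eq_in_map duv; apply: inj => s sS; apply: duv; rewrite mem_enum.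
Qed.

Lemma resolving_setT (G : sgraph) : resolving [set: G].
Proof.
apply/resolvingP=> u v /(_ v (in_setT v)) duv.
by apply/eqP; rewrite -dist_eq0 duv dist_eq0.
Qed.

Lemma ft_resolving_setT (G : sgraph) : 0 < #|G| -> ft_resolving [set: G].
Proof.
move=> G0; rewrite /ft_resolving -card_gt0 cardsT G0.
apply/'forall_implyP=> s _; apply/resolvingP=> u v duv.
have [-> //|uv] := eqVneq u v.
have [us|us] := eqVneq u s.
  have /duv : v \in [set: G] :\ s by rewrite !inE -us eq_sym uv.
  by move/eqP; rewrite [dist v v](eqP (_ : _ == Some 0)) ?dist_eq0 // => /eqP.
have /duv : u \in [set: G] :\ s by rewrite !inE us.
move/eqP; rewrite [dist u u](eqP (_ : _ == Some 0)) ?dist_eq0 // eq_sym.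
by rewrite dist_eq0 => /eqP.
Qed.

Definition dim (G : sgraph) : nat :=
  #|[arg min_(S < [set: G] | resolving S) #|S| ]|.

(* By ft_resolving_setT the default set is admissible as soon as G has a
   vertex; on the empty graph no set is admissible and ftdim is 0. *)
Definition ftdim (G : sgraph) : nat :=
  #|[arg min_(S < [set: G] | ft_resolving S) #|S| ]|.

Lemma dimP (G : sgraph) n :
  dim G = n <-> (exists2 S : {set G}, resolving S & #|S| = n) /\
                forall S : {set G}, resolving S -> n <= #|S|.
Proof.
rewrite /dim; case: arg_minnP => [|S rS Smin]; first exact: resolving_setT.
split=> [<-|[[S' rS' <-] S'min]]; first by split=> //; exists S.
by apply/eqP; rewrite eqn_leq Smin // S'min.
Qed.

Lemma ftdimP (G : sgraph) n : 0 < #|G| ->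
  ftdim G = n <-> (exists2 S : {set G}, ft_resolving S & #|S| = n) /\
                  forall S : {set G}, ft_resolving S -> n <= #|S|.
Proof.
move=> G0; rewrite /ftdim; case: arg_minnP => [|S rS Smin].
  exact: ft_resolving_setT.
split=> [<-|[[S' rS' <-] S'min]]; first by split=> //; exists S.
by apply/eqP; rewrite eqn_leq Smin // S'min.
Qed.

Section Induced.
Context (G : sgraph) (A : {set G}).

Definition induced_edge : rel {x : G | x \in A} :=
  fun u v => sedge (val u) (val v).

Fact induced_edge_sym : symmetric induced_edge.
Proof. by move=> u v; apply: sedge_sym. Qed.

Fact induced_edge_irrefl : irreflexive induced_edge.
Proof. by move=> u; apply: sedge_irrefl. Qed.

Definition induced : sgraph := SGraph induced_edge_sym induced_edge_irrefl.
End Induced.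

Inductive Jvertex (k : nat) : Type :=
  | Jcenter
  | Jleaf of k.-tuple 'I_3
  | Js of 'I_k
  | Jr of 'I_k.
Arguments Jcenter {k}.

Section JvertexFinite.
Context (k : nat).

Definition Jvertex_code (u : Jvertex k) :
    option (k.-tuple 'I_3 + ('I_k + 'I_k)) :=
  match u with
  | Jcenter => None
  | Jleaf x => Some (inl x)
  | Js i => Some (inr (inl i))
  | Jr i => Some (inr (inr i))
  end.

Definition Jvertex_decode (c : option (k.-tuple 'I_3 + ('I_k + 'I_k))) :
    Jvertex k :=
  match c with
  | None => Jcenter
  | Some (inl x) => Jleaf x
  | Some (inr (inl i)) => Js i
  | Some (inr (inr i)) => Jr i
  end.

Fact Jvertex_codeK : cancel Jvertex_code Jvertex_decode.
Proof. by case. Qed.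

HB.instance Definition _ := Finite.copy (Jvertex k) (can_type Jvertex_codeK).
End JvertexFinite.

(* Each edge in one orientation. *)
Definition Jarc (k : nat) (u v : Jvertex k) : bool :=
  match u, v with
  | Jcenter, Jleaf _ => true
  | Js i, Jleaf x => tnth x i == 0 :> nat
  | Jr i, Jleaf x => (tnth x i == 0 :> nat) || (tnth x i == 1 :> nat)
  | Jr i, Js j => i == j
  | _, _ => false
  end.

Definition Jedge (k : nat) : rel (Jvertex k) :=
  fun u v => Jarc u v || Jarc v u.

Fact Jedge_sym (k : nat) : symmetric (@Jedge k).
Proof. by move=> u v; apply: orbC. Qed.

Fact Jedge_irrefl (k : nat) : irreflexive (@Jedge k).
Proof. by case. Qed.

(* The graph before the deletion of leaves. *)
Definition Jfull (k : nat) : sgraph := SGraph (@Jedge_sym k) (@Jedge_irrefl k).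

Definition Jdeleted_label (k : nat) (x : k.-tuple 'I_3) : bool :=
  all (fun d : 'I_3 => d == 1 :> nat) x
  || (count (fun d : 'I_3 => d == 0 :> nat) x == 1)
     && (count (fun d : 'I_3 => d == 1 :> nat) x == k - 1).

Definition Jdeleted (k : nat) : {set Jfull k} :=
  [set @Jleaf k x | x : k.-tuple 'I_3 & Jdeleted_label x].

(* J 1 consists of two disjoint edges (center - leaf 2, s_1 - r_1), so its
   metric dimension is 2, not 1. *)
Definition J (k : nat) : sgraph := induced (~: Jdeleted k).

(* Main.v *)
Require Import Defs.
From mathcomp Require Import all_boot zify.

(* For k > 1 the all-0 leaf survives and J k has diameter 3, so a resolving set
   of size m < k gives at most m + 3^m vertices, fewer than J k has. The
   distances to s_1, ..., s_k send a leaf x to (x_i + 1)_i; the center and the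
   r_j get exactly the vectors of the deleted leaves, so the s_i resolve J k.
   For ftdim, two leaves differing in their first digit only, 0 against 1, are
   separated by no vertex besides s_1 and themselves, so a fault-tolerant set
   contains one of them; at most k of these 3^(k-1) disjoint pairs lose a leaf
   to the deletion. *)

Set Implicit Arguments.
Unset Strict Implicit.
Unset Printing Implicit Defensive.

(** * Distances and resolving sets in graphs of diameter at most 3 *)

Lemma walk1 (G : sgraph) (u v : G) : sedge u v -> walk 1 u v.
Proof. by move=> uv; apply/existsP; exists [tuple v]; rewrite /= uv eqxx. Qed.

Lemma walk_step (G : sgraph) n (u v w : G) :
  sedge u v -> walk n v w -> walk n.+1 u w.
Proof.
move=> uv /existsP[p /andP[pp lp]]; apply/existsP.
by exists [tuple of v :: p]; rewrite /= uv pp.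
Qed.

Lemma dist_diam3 (G : sgraph) :
  (forall u v : G, exists2 n, n <= 3 & walk n u v) ->
  forall u v : G, dist u v =
    Some (if u == v then 0 else if sedge u v then 1
          else if [exists w, sedge u w && sedge w v] then 2 else 3).
Proof.
move=> diam u v.
have [n le_n3 wn] := diam u v.
have w0 m : walk m u v -> m = 0 -> u == v.
  by move=> /existsP[p +] m0; subst m; rewrite (tuple0 p).
have w1 m : walk m u v -> m = 1 -> sedge u v.
  move=> /existsP[p +] m1; subst m; case/tupleP: p => a p.
  by rewrite (tuple0 p) /= andbT => /andP[ua /eqP <-].
have w2 m : walk m u v -> m = 2 -> [exists w, sedge u w && sedge w v].
  move=> /existsP[p +] m2; subst m; case/tupleP: p => a p.
  case/tupleP: p => b p; rewrite (tuple0 p) /= andbT => /andP[uab /eqP <-].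
  by apply/existsP; exists a.
apply/dist_SomeP; case: eqP => [uv|/eqP/negP nuv].
  split=> //; apply/existsP; exists [tuple] => /=; exact/eqP.
case: ifP => [uv|/negP ne].
  split=> [|m wm]; first exact: walk1.
  by case: m wm => // /w0/(_ erefl).
case: ifPn => [/existsP[w /andP[uw wv]]|/negP nc].
  split=> [|[|[|m]] wm] //; first exact: walk_step uw (walk1 wv).
  - by move/w0: wm => /(_ erefl).
  - by move/w1: wm => /(_ erefl).
have ge3 m : walk m u v -> 3 <= m.
  case: m => [|[|[|m]]] wm //.
  - by move/w0: wm => /(_ erefl).
  - by move/w1: wm => /(_ erefl).
  - by move/w2: wm => /(_ erefl).
by split=> //; move/ge3: (wn) => ge_n3; rewrite (_ : 3 = n) //; lia.
Qed.

(** A vertex outside [S] is determined by its distances to [S], and each of these is 1, 2 or 3. *)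
Lemma card_resolving_diam3 (G : sgraph) (S : {set G}) :
  (forall u v : G, exists2 n, n <= 3 & walk n u v) ->
  resolving S -> #|G| <= #|S| + 3 ^ #|S|.
Proof.
move=> diam /resolvingP rS.
(* The predecessor shifts the distances 1, 2, 3 into ['I_3]. The value [ord0] off [S] makes [F u] a
   function supported in [S], and there are [3 ^ #|S|] of those. *)
pose F u : {ffun G -> 'I_3} :=
  [ffun s => if s \in S then inord (odflt 0 (dist u s)).-1 else ord0].
rewrite -(cardsC S) leq_add2l.
rewrite -[X in X ^ _](card_ord 3) -(card_pffun_on ord0 (mem S) (mem 'I_3)).
have injF : {in ~: S &, injective F}.
  move=> u v; rewrite !inE => uS vS /ffunP eqF; apply: rS => s sS.
  have us : (u == s) = false by apply: contraNF uS => /eqP->.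
  have vs : (v == s) = false by apply: contraNF vS => /eqP->.
  move: (eqF s); rewrite !ffunE sS !(dist_diam3 diam) us vs /=.
  by do ?case: ifP => _ /=; move=> /(congr1 val); rewrite /= !inordK.
rewrite -(card_in_imset injF); apply: subset_leq_card.
apply/subsetP=> _ /imsetP[u uS ->]; apply/pffun_onP; split=> //.
by apply/subsetP=> s; rewrite !inE ffunE; case: ifP; rewrite ?eqxx.
Qed.

(** * Deleted labels and distances in [J k] *)

Section J.
Variable k : nat.
Implicit Types (x y : k.-tuple 'I_3) (i j : 'I_k).

Lemma count_tnth (P : pred 'I_3) x : count P x = #|[pred i | P (tnth x i)]|.
Proof.
rewrite -{1}(map_tnth_enum x) count_map cardE enumT -size_filter.
by rewrite /enum_mem.
Qed.

Lemma Jdeleted_labelP x :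
  reflect ((forall i, tnth x i = 1 :> nat) \/
           exists j, forall i, tnth x i = (i != j) :> nat)
          (Jdeleted_label x).
Proof.
rewrite /Jdeleted_label.
have oneP : reflect (forall i, tnth x i = 1 :> nat)
                    (all (fun d : 'I_3 => d == 1 :> nat) x).
  by apply: (iffP all_tnthP) => h i; apply/eqP; rewrite ?h //; apply/eqP/h.
apply: (iffP orP) => [[/oneP|]|[/oneP|[j xj]]]; [by left| |by left|right].
  rewrite !count_tnth => /andP[/eqP/mem_card1[j j0] /eqP c1].
  right; exists j; have j0' i : (tnth x i == 0 :> nat) = (i == j).
    by have := j0 i; rewrite !inE.
  (* The positions of digit 1 avoid [j] and number [k - 1], so they are all the positions other than
     [j]. *)
  have /subset_cardP sub1 : #|[pred i | tnth x i == 1 :> nat]| = #|predC1 j|.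
    by rewrite c1 cardC1 card_ord subn1.
  have {}sub1 := sub1 _; move=> i; have [->|ij] := eqVneq i j.
    by apply/eqP; rewrite j0'.
  suff /sub1/(_ i) : [pred i | tnth x i == 1 :> nat] \subset predC1 j.
    by rewrite !inE ij => /eqP.
  by apply/subsetP=> l; rewrite !inE -j0' => /eqP->.
rewrite !count_tnth; apply/andP; split.
  apply/eqP; rewrite (eq_card (_ : _ =i pred1 j)) ?card1 // => i.
  by rewrite !inE xj; case: (i == j).
have -> : k - 1 = #|predC1 j| by rewrite cardC1 card_ord subn1.
apply/eqP/eq_card => i.
by rewrite !inE xj; case: (i == j).
Qed.

Lemma mem_Jkept (a : Jvertex k) :
  (a \in ~: Jdeleted k) = if a is Jleaf x then ~~ Jdeleted_label x else true.
Proof.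
rewrite inE; case: a => [|x|i|i]; last 2 first.
- by apply/imsetP=> -[].
- by apply/imsetP=> -[].
- by apply/imsetP=> -[].
congr (~~ _); apply/imsetP/idP => [[y + [->]]|dx]; first by rewrite inE.
by exists x; rewrite ?inE.
Qed.

Definition J_s j : J k := exist _ (Js j : Jfull k) (mem_Jkept (Js j)).

Lemma J_vertex (a : Jvertex k) :
  (if a is Jleaf x then ~~ Jdeleted_label x else true) ->
  exists u : J k, val u = a.
Proof. by rewrite -mem_Jkept => ka; exists (Sub a ka); rewrite SubK. Qed.

Lemma J_edgeE (u v : J k) : sedge u v = Jedge (val u) (val v).
Proof. by []. Qed.

Lemma Jedge_leaf_s x j : Jedge (Jleaf x) (Js j) = (tnth x j == 0 :> nat).
Proof. by []. Qed.

Lemma Jedge_leaf_r x j : Jedge (Jleaf x) (Jr j) = (tnth x j != 2 :> nat).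
Proof. by rewrite /Jedge /=; case: (tnth x j) => -[|[|[|]]]. Qed.

Hypothesis k_gt1 : 1 < k.

(* At k = 1 the label 0 is deleted. *)
Lemma J_zero_leaf :
  exists z : J k, val z = Jleaf [tuple ord0 | i < k].
Proof.
have k_gt0 : 0 < k by lia.
have [|z zE] := @J_vertex (Jleaf [tuple ord0 | i < k]); last by exists z.
apply/Jdeleted_labelP=> -[/(_ (Ordinal k_gt0))|[j xj]].
  by rewrite tnth_mktuple.
(* An index other than [j], where the digit would have to be 1. *)
have := xj (if j == Ordinal k_gt0 then Ordinal k_gt1 else Ordinal k_gt0).
by rewrite tnth_mktuple; case: (eqVneq j) => [->|]; rewrite // eq_sym => ->.
Qed.

(** The center is adjacent to all leaves and the all-0 leaf to all other vertices; these two hubs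
    are adjacent to each other. *)
Lemma J_diam (u v : J k) : exists2 n, n <= 3 & walk n u v.
Proof.
have [z zE] := J_zero_leaf.
have [c cE] := @J_vertex Jcenter isT.
have zv (w : J k) : (if val w is Jleaf _ then false else true) -> sedge z w.
  rewrite J_edgeE zE; case: (val w) => // i _;
    by rewrite /Jedge /= tnth_mktuple.
have vz (w : J k) : (if val w is Jleaf _ then false else true) -> sedge w z.
  by rewrite sedge_sym; apply: zv.
have cv (w : J k) : (if val w is Jleaf _ then true else false) -> sedge c w.
  by rewrite J_edgeE cE; case: (val w).
have vc (w : J k) : (if val w is Jleaf _ then true else false) -> sedge w c.
  by rewrite sedge_sym; apply: cv.
have [lu|nu] := boolP (if val u is Jleaf _ then true else false);
have [lv|nv] := boolP (if val v is Jleaf _ then true else false).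
- by exists 2 => //; apply: walk_step (vc _ lu) (walk1 (cv _ lv)).
- exists 3 => //; apply: walk_step (vc _ lu) _.
  apply: (@walk_step _ _ _ z); first by apply: cv; rewrite zE.
  by apply/walk1/zv; move: nv; case: (val v).
- exists 3 => //; apply: (@walk_step _ _ _ z).
    by apply: vz; move: nu; case: (val u).
  apply: (@walk_step _ _ _ c); first by apply: vc; rewrite zE.
  exact/walk1/cv.
- exists 2 => //; apply: (@walk_step _ _ _ z).
    by apply: vz; move: nu; case: (val u).
  by apply/walk1/zv; move: nv; case: (val v).
Qed.

(** A leaf with digit 0 at [j] is a neighbour, one with digit 1 is joined through [Jr j], and one
    with digit 2 has no common neighbour with [Js j]. A non-leaf has the all-0 leaf as a common
    neighbour with [Js j]. *)
Lemma dist_J_s (u v : J k) j : val v = Js j ->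
  dist u v = Some match val u with
                  | Jcenter => 2
                  | Jleaf x => (tnth x j).+1
                  | Js i => if i == j then 0 else 2
                  | Jr i => if i == j then 1 else 2
                  end.
Proof.
move=> vj; have [z zE] := J_zero_leaf.
have zv : sedge z v by rewrite J_edgeE zE vj /Jedge /= tnth_mktuple.
rewrite (dist_diam3 J_diam) -val_eqE J_edgeE vj; congr Some.
have via_z : sedge u z -> [exists w, sedge u w && sedge w v].
  by move=> uz; apply/existsP; exists z; rewrite uz.
move: via_z; rewrite J_edgeE zE; case uE: (val u) => [|x|i|i] via_z.
- by rewrite via_z.
- rewrite Jedge_leaf_s; case: ifP => [/eqP->//|x0].
  case: ifPn => [/existsP[w]|].
    rewrite !J_edgeE uE vj; case: (val w) => [|y|i|i] /andP[] //.
    rewrite Jedge_leaf_r /Jedge /= orbF => + /eqP ij; move: x0; rewrite -ij.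
    by case: (tnth x i) => -[|[|[|]]].
  have [r rE] := @J_vertex (Jr j) isT.
  move/existsPn/(_ r).
  rewrite !J_edgeE uE vj rE Jedge_leaf_r /Jedge /= eqxx andbT.
  by case: (tnth x j) x0 => -[|[|[|]]].
- rewrite via_z; last by rewrite /Jedge /= tnth_mktuple.
  by rewrite (inj_eq (_ : injective (@Js k))) => [|? ? []].
- rewrite via_z; last by rewrite /Jedge /= tnth_mktuple.
  by rewrite /Jedge /= orbF.
Qed.

Lemma dist_J_leaf_c (u v : J k) x :
  val u = Jleaf x -> val v = Jcenter -> dist u v = Some 1.
Proof.
by move=> ux vc; rewrite (dist_diam3 J_diam) -val_eqE J_edgeE ux vc.
Qed.

Lemma dist_J_leaf_r (u v : J k) x j : val u = Jleaf x -> val v = Jr j ->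
  dist u v = Some (if tnth x j == 2 :> nat then 3 else 1).
Proof.
move=> ux vj; rewrite (dist_diam3 J_diam) -val_eqE J_edgeE ux vj.
rewrite Jedge_leaf_r; congr Some; case: eqP => // xj2.
(* The only non-leaf neighbour of [Jr j] is [Js j], which misses a leaf with digit 2 at [j]. *)
case: existsP => // -[w].
rewrite !J_edgeE ux vj; case: (val w) => [|y|i|i] /andP[] //.
by rewrite Jedge_leaf_s /Jedge /= => + /eqP ij; rewrite -ij xj2.
Qed.

Lemma dist_J_leaves (u v : J k) x y : val u = Jleaf x -> val v = Jleaf y ->
  u != v -> dist u v = Some 2.
Proof.
move=> ux vy uv; rewrite (dist_diam3 J_diam) (negbTE uv) J_edgeE ux vy.
have [c cE] := @J_vertex Jcenter isT.
by case: existsP => // -[]; exists c; rewrite !J_edgeE ux vy cE.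
Qed.

(** Only [Js j] has a coordinate 0. The center has all coordinates 2, and [Jr j] has 1 at [j] and 2
    elsewhere; a leaf sharing such a vector would carry a deleted label. *)
Lemma J_s_resolving : resolving [set J_s j | j : 'I_k].
Proof.
apply/resolvingP=> u v duv; apply: val_inj.
have {duv} : forall j, dist u (J_s j) = dist v (J_s j).
  by move=> j; apply: duv; apply/imsetP; exists j.
have := valP u; have := valP v; rewrite !mem_Jkept.
have du j := @dist_J_s u (J_s j) j erefl.
have dv j := @dist_J_s v (J_s j) j erefl.
move=> kv ku duv; have {duv} : forall j, Some _ = Some _ :> option nat :=
  fun j => etrans (esym (du j)) (etrans (duv j) (dv j)).
case: (val u) ku => [|x|i|i]; case: (val v) kv => [|y|j|j] // kv ku duv.
- case/Jdeleted_labelP: kv; left=> j.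
  by have [] := duv j.
- by have := duv j; rewrite eqxx.
- by have := duv j; rewrite eqxx.
- case/Jdeleted_labelP: ku; left=> j.
  by have [] := duv j.
- congr Jleaf; apply: eq_from_tnth => j; apply: val_inj.
  by have [] := duv j.
- by have := duv j; rewrite eqxx.
- case/Jdeleted_labelP: ku; right; exists j => i.
  by have := duv i; rewrite eq_sym; case: eqP => _ [].
- by have := duv i; rewrite eqxx.
- by have := duv i; rewrite eqxx.
- by have := duv i; rewrite eqxx; case: eqP => // ->.
- by have := duv i; rewrite eqxx; case: eqP.
- by have := duv i; rewrite eqxx.
- case/Jdeleted_labelP: kv; right; exists i => j.
  by have := duv j; rewrite eq_sym; case: eqP => _ [].
- by have := duv j; rewrite eqxx; case: eqP.
- by have := duv i; rewrite eqxx; case: eqP => // ->.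
Qed.

End J.

(** * Counting leaves by their first digit *)

Section JS.
Variable k : nat.
Implicit Types (w : k.-tuple 'I_3) (d : 'I_3).

Lemma tnth_cons d w i :
  tnth [tuple of d :: w] i = if unlift ord0 i is Some j then tnth w j else d.
Proof.
case: unliftP => [j|] ->; last by [].
by rewrite (tnth_nth d) /= (tnth_nth d).
Qed.

(** No deleted label contains the digit 2, so all leaves with first digit 2 survive; the vertices
    [Js j] are added to them. *)
Lemma card_J_lower : 3 ^ k + k.+1 <= #|J k.+1|.
Proof.
have kept w : @Jleaf k.+1 [tuple of ord_max :: w] \in ~: Jdeleted k.+1.
  rewrite mem_Jkept; apply/Jdeleted_labelP=> -[/(_ ord0)|[j /(_ ord0)]].
    by rewrite tnth_cons unlift_none.
  by rewrite tnth_cons unlift_none; case: eqP.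
pose f (a : k.-tuple 'I_3 + 'I_k.+1) : J k.+1 :=
  match a with
  | inl w => exist _ (Jleaf _ : Jfull _) (kept w)
  | inr j => J_s j
  end.
have f_inj : injective f.
  move=> [w|i] [w'|j] /(congr1 val) //= [].
    by move=> ww; congr inl; apply: val_inj.
  by move=> ->.
have := leq_card f f_inj.
by rewrite card_sum card_tuple !card_ord.
Qed.

(* None encodes the all-1 string, Some j the one whose only 0 is at j. *)
Definition one_zero (o : option 'I_k) : k.-tuple 'I_3 :=
  [tuple inord (Some i != o) | i < k].

(** Bounds the damage done by the deletion: only [k.+1] tails [w] can belong to a deleted label. *)
Lemma Jdeleted_cons d w : Jdeleted_label [tuple of d :: w] ->
  w \in [set one_zero o | o : option 'I_k].
Proof.
case/Jdeleted_labelP=> [w1|[j wj]].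
  apply/imsetP; exists None => //; apply: eq_from_tnth => i.
  have := w1 (lift ord0 i); rewrite tnth_cons liftK tnth_mktuple => wi.
  by apply: val_inj; rewrite /= inordK.
(* If the only 0 is the first digit, [unlift] gives [None] and the tail is all 1. *)
apply/imsetP; exists (unlift ord0 j) => //; apply: eq_from_tnth => i.
have := wj (lift ord0 i); rewrite tnth_cons liftK tnth_mktuple => wi.
apply: val_inj; rewrite /= inordK //; last by case: eqP.
rewrite wi; by case: unliftP => [j'|] -> //; rewrite (inj_eq lift_inj).
Qed.

(** Each tail outside [del] yields a pair of surviving leaves, of which [S] contains one; forgetting
    the first digit thus maps [S] onto a set covering all these tails. *)
Lemma ft_resolving_J (S : {set J k.+1}) (k_gt0 : 0 < k) :
  ft_resolving S -> 3 ^ k - k.+1 <= #|S|.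
Proof.
case/andP=> /set0Pn[s0 s0S] /'forall_implyP ftS.
pose del := [set one_zero o | o : option 'I_k].
have kept d w : w \in ~: del ->
    exists u : J k.+1, val u = Jleaf [tuple of d :: w].
  rewrite inE => wdel; apply: J_vertex.
  by apply: contra wdel; apply: Jdeleted_cons.
have pick w : w \in ~: del -> exists2 u : J k.+1, u \in S &
    exists d : 'I_3, val u = Jleaf [tuple of d :: w].
  move=> wdel.
  have [u uE] := kept ord0 w wdel.
  have [v vE] := kept (inord 1) w wdel.
  have [uS|uS] := boolP (u \in S); first by exists u => //; exists ord0.
  have [vS|vS] := boolP (v \in S); first by exists v => //; exists (inord 1).
  (* Fault tolerance is applied to [J_s ord0] if it lies in [S], and otherwise to an arbitrary
     element of [S]. *)
  have [s sS sP] : exists2 s, s \in S & J_s ord0 \notin S :\ s.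
    have [tS|tS] := boolP (J_s ord0 \in S).
      by exists (J_s ord0); rewrite ?inE ?eqxx.
    by exists s0; rewrite // inE negb_and tS orbT.
  have /resolvingP/(_ u v) := ftS s sS.
  suff duv : {in S :\ s, forall t, dist u t = dist v t}.
    move=> /(_ duv)/(congr1 val); rewrite uE vE => -[/(congr1 val)].
    by rewrite /= inordK.
  move=> t tSs; have tS : t \in S by move: tSs; rewrite inE => /andP[].
  (* A leaf [t] differs from [u] and [v], so it is at distance 2 from both; [Js i] with [i] nonzero
     reads a digit of the common tail; [Jr i] does not separate the digits 0 and 1. *)
  case tE: (val t) => [|x|i|i].
  - by rewrite (dist_J_leaf_c _ uE tE) // (dist_J_leaf_c _ vE tE).
  - rewrite (dist_J_leaves _ uE tE) //; last by apply: contraNneq uS => ->.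
    by rewrite (dist_J_leaves _ vE tE) //; last by apply: contraNneq vS => ->.
  - rewrite !(dist_J_s _ _ tE) // uE vE !tnth_cons.
    case: unliftP tE => // -> tE; case/negP: sP.
    by rewrite (_ : J_s ord0 = t) //; apply: val_inj.
  - rewrite (dist_J_leaf_r _ uE tE) // (dist_J_leaf_r _ vE tE) // !tnth_cons.
    by case: unliftP => // _; rewrite inordK.
(* [one_zero None] is a filler value for non-leaves. *)
pose f (u : J k.+1) : k.-tuple 'I_3 :=
  if val u is Jleaf x then [tuple of behead x] else one_zero None.
have sub : ~: del \subset f @: S.
  apply/subsetP=> w /pick[u uS [d uE]]; apply/imsetP; exists u => //.
  by rewrite /f uE; apply: val_inj.
have := leq_trans (subset_leq_card sub) (leq_imset_card f S).
apply: leq_trans; rewrite leq_subLR.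
have card_del : #|del| <= k.+1.
  by apply: leq_trans (leq_imset_card _ _) _; rewrite card_option card_ord.
have := cardsC del; rewrite card_tuple card_ord => <-.
by rewrite leq_add2r.
Qed.

End JS.

Theorem theorem6 (k : nat) (k_gt0 : 0 < k) :
  (k <> 1 -> dim (J k) = k) /\ 3 ^ (k - 1) - k <= ftdim (J k).
Proof.
split=> [k1|].
  have k_gt1 : 1 < k by lia.
  apply/dimP; split=> [|S rS].
    exists [set J_s j | j : 'I_k]; first exact: J_s_resolving.
    by rewrite card_imset ?card_ord // => i j /(congr1 val)[].
  rewrite leqNgt; apply/negP => Sk.
  have := card_resolving_diam3 (J_diam k_gt1) rS.
  (* With [k.+1] for [k], the assumption reads [#|S| <= k], and [#|S| + 3 ^ #|S|] stays below
     [3 ^ k + k.+1]. *)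
  case: k k_gt0 S {rS} Sk {k1 k_gt1} => // k _ S Sk.
  have := card_J_lower k.
  have : 3 ^ #|S| <= 3 ^ k by rewrite leq_exp2l.
  by lia.
(* At [k = 1] the bound is [3 ^ 0 - 1 = 0]. *)
case: k k_gt0 => [//|[|k]] _; first by rewrite subnn.
rewrite subn1 /ftdim; case: arg_minnP => [|S ftS _]; last exact: ft_resolving_J.
by apply: ft_resolving_setT; apply: leq_trans (card_J_lower _); rewrite addnS.
Qed.
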